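(* Suppose $\mathbb{R}^m$ is endowed with the Euclidean norm $\|\cdot\|_2$, $\mathbb{R}^n$ is endowed with a norm $\|\cdot\|$, and $D(x,y)=\frac12\|x-y\|^2$. If $f(x)=\frac12\|Ax-b\|_2^2$ for some $A\in\mathbb{R}^{m\times n}$ and $b\in\mathbb{R}^m$, and $X\subseteq\mathbb{R}^n$ is a polyhedron such that $A(X)$ contains more than one point, then \[ \mu_{f,X,D}=\min_{C\in\mathcal{T}(A|X)}\frac{1}{\|(A|C)^{-1}\|^2}. \]
   Context: Bregman distance: $D_f(y,x)=f(y)-f(x)-\langle\nabla f(x),y-x\rangle$. For nonempty $S\subseteq X$, $D_f(S,x):=\inf_{y\in S}D_f(y,x)$ and $D(S,x):=\inf_{y\in S}D(y,x)$. For $y\in X$, $Z_{f,X}(y):=\{x\in X: f(x)=f(y)\text{ and }\langle\nabla f(x)-\nabla f(y),x-y\rangle=0\}$. The relative strong convexity constant is \[ \mu_{f,X,D}:=\sup\{\mu\ge0:\ D_f(Z_{f,X}(y),x)\ge\mu\,D(Z_{f,X}(y),x)\text{ for all }x,y\in X\}. \] For a convex cone $C\subseteq\mathbb{R}^n$, \[ \|(A|C)^{-1}\|:=\sup_{v\in A(C),\,\|v\|_2\le1}\ \inf_{x\in C,\,Ax=v}\|x\|. \] Tangent cones: for $x\in X$, $T_X(x):=\{d\in\mathbb{R}^n: x+td\in X\text{ for some }t>0\}$, and $\mathcal{T}(X):=\{T_X(x):x\in X\}$ (a finite set). $\mathcal{T}(A|X)$ is the set of those $C\in\mathcal{T}(X)$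 such that $A(C)$ is a linear subspace and $C$ is minimal with respect to inclusion among the cones in $\mathcal{T}(X)$ with this property. *)

(* Defs.v *)
From HB Require Import structures.
From mathcomp Require Import all_boot all_order all_algebra.
From mathcomp Require Import all_classical all_reals all_analysis.

Set Implicit Arguments.
Unset Strict Implicit.
Unset Printing Implicit Defensive.

Import Order.TTheory GRing.Theory Num.Theory numFieldNormedType.Exports.
Local Open Scope classical_set_scope.
Local Open Scope ring_scope.

Section Euclidean.
Variables (R : realType) (n : nat).
Implicit Types (u v x : 'cV[R]_n) (X : set 'cV[R]_n).

Definition dot u v : R := \sum_i u i 0 * v i 0.

Definition enorm v : R := Num.sqrt (dot v v).

(* The library norm on ['cV[R]_n] is the sup norm, hence an explicit predicate
   for an arbitrary norm. *)
Definition is_norm (N : 'cV[R]_n -> R) : Prop :=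
  [/\ forall x, N x = 0 -> x = 0,
      forall (a : R) x, N (a *: x) = `|a| * N x
    & forall x y, N (x + y) <= N x + N y].

Definition polyhedron X : Prop :=
  exists (p : nat) (G : 'M[R]_(p, n)) (h : 'cV[R]_p),
    X = [set x | forall i, (G *m x) i 0 <= h i 0].

Definition grad (f : 'cV[R]_n -> R) x : 'cV[R]_n :=
  \col_i 'D_(delta_mx i 0) f x.

End Euclidean.

Section RelativeStrongConvexity.
Variables (R : realType) (n : nat).
Implicit Types (f : 'cV[R]_n -> R) (X S : set 'cV[R]_n).
Implicit Types (D : 'cV[R]_n -> 'cV[R]_n -> R).

Definition bregman f (y x : 'cV[R]_n) : R :=
  f y - f x - dot (grad f x) (y - x).

Definition set_dist D S (x : 'cV[R]_n) : \bar R :=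
  ereal_inf [set (D y x)%:E | y in S].

Definition Zset f X (y : 'cV[R]_n) : set 'cV[R]_n :=
  [set x | X x /\ f x = f y /\ dot (grad f x - grad f y) (x - y) = 0].

(* The supremum is taken in [\bar R], so that no boundedness is presupposed. *)
Definition rel_strong_convexity f X D : \bar R :=
  ereal_sup [set mu%:E | mu in [set mu : R | 0 <= mu /\
    forall x y, X x -> X y ->
      (mu%:E * set_dist D (Zset f X y) x
        <= set_dist (bregman f) (Zset f X y) x)%E]].

End RelativeStrongConvexity.

Section TangentCones.
Variables (R : realType) (m n : nat).
Implicit Types (A : 'M[R]_(m, n)) (X C : set 'cV[R]_n).

Definition mximage A C : set 'cV[R]_m := [set A *m x | x in C].

(* No finiteness is built in: the value lies in [\bar R]. *)
Definition cone_inv_norm (N : 'cV[R]_n -> R) A C : \bar R :=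
  ereal_sup [set ereal_inf [set (N x)%:E | x in [set x | C x /\ A *m x = v]]
            | v in [set v | mximage A C v /\ enorm v <= 1]].

Definition tangent_cone X (x : 'cV[R]_n) : set 'cV[R]_n :=
  [set d | exists2 t : R, 0 < t & X (x + t *: d)].

Definition tangent_cones X : set (set 'cV[R]_n) :=
  [set tangent_cone X x | x in X].

Definition linear_tangent_cone A X : set (set 'cV[R]_n) :=
  [set C | tangent_cones X C /\ submod_closed (mem (mximage A C))].

Definition min_linear_tangent_cone A X : set (set 'cV[R]_n) :=
  [set C | linear_tangent_cone A X C /\
     forall C', linear_tangent_cone A X C' -> C' `<=` C -> C' = C].

End TangentCones.

Definition is_minimum (R : realType) (S : set (\bar R)) (m : \bar R) : Prop :=
  S m /\ lbound S m.

(* Main.v *)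
Require Import Defs.
From mathcomp Require Import all_boot all_order all_algebra.
From mathcomp Require Import all_classical all_reals all_analysis.
From mathcomp Require Import ring lra.

(* Here the set Z(y) is {z in X : A z = A y} and D_f(y, x) = |A (y - x)|^2 / 2, so
   a constant mu > 0 is admissible iff every x, y in X satisfy the error bound
   dist(x, Z(y)) <= mu^(-1/2) |A (y - x)|.

   Lower bound on the error constant: for v = A d with d in T(x) and t small, a
   point z of X close to x with A z = A x + t v yields z - x in T(x), hence the
   preimage (z - x) / t of v.  Hence mu^(-1/2) dominates the norm of every tangent
   cone.

   Upper bound: let A x be in the relative interior of A(X), i.e., A(T(x)) linear.
   Lift the segment [A x, A y] to X step by step, moving at each z along a short
   preimage of A (y - x) in a minimal cone contained in T(z); compactness shows
   that A y is reached.  An arbitrary x is approximated by x + e (x0 - x), where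
   T(x0) is maximal.  Finiteness of the set of tangent cones yields x0, the
   minimal cones and the maximum of their norms. *)

Set Implicit Arguments.
Unset Strict Implicit.

Import Order.TTheory GRing.Theory Num.Theory numFieldNormedType.Exports.
Local Open Scope classical_set_scope.
Local Open Scope ring_scope.

(** * Euclidean inner product and norm *)

Section EuclideanNorm.
Variables (R : realType) (m : nat).
Implicit Types (u v w : 'cV[R]_m).

Lemma dotC u v : dot u v = dot v u.
Proof. by apply: eq_bigr => i _; rewrite mulrC. Qed.

Lemma dotDl u v w : dot (u + v) w = dot u w + dot v w.
Proof. by rewrite -big_split; apply: eq_bigr => i _; rewrite mxE mulrDl. Qed.

Lemma dotZl a u v : dot (a *: u) v = a * dot u v.
Proof. by rewrite mulr_sumr; apply: eq_bigr => i _; rewrite mxE mulrA. Qed.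

Lemma dotDr u v w : dot w (u + v) = dot w u + dot w v.
Proof. by rewrite dotC dotDl !(dotC w). Qed.

Lemma dotZr a u v : dot u (a *: v) = a * dot u v.
Proof. by rewrite dotC dotZl dotC. Qed.

Lemma dot_ge0 v : 0 <= dot v v.
Proof. by apply: sumr_ge0 => i _; rewrite -expr2 sqr_ge0. Qed.

Lemma dot_eq0 v : (dot v v == 0) = (v == 0).
Proof.
apply/eqP/eqP => [v0|->]; last by apply: big1 => i _; rewrite mxE mul0r.
apply/colP => i; rewrite mxE; apply/eqP; rewrite -sqrf_eq0 expr2; apply/eqP.
move: i (erefl true) => i; apply: (psumr_eq0P _ v0) => j _.
by rewrite -expr2 sqr_ge0.
Qed.

Lemma enorm_sqr v : enorm v ^+ 2 = dot v v.
Proof. by rewrite sqr_sqrtr ?dot_ge0. Qed.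

Lemma enorm_ge0 v : 0 <= enorm v.
Proof. exact: sqrtr_ge0. Qed.

Lemma enorm_eq0 v : (enorm v == 0) = (v == 0).
Proof. by rewrite -sqrf_eq0 enorm_sqr dot_eq0. Qed.

Lemma enormZ a v : enorm (a *: v) = `|a| * enorm v.
Proof.
by rewrite /enorm dotZl dotZr mulrA -expr2 sqrtrM ?sqr_ge0// sqrtr_sqr.
Qed.

(** Cauchy-Schwarz: expand the nonnegative square of [enorm v *: u - enorm u *: v] and divide by
    [enorm u * enorm v]. *)
Lemma dot_le_enorm u v : dot u v <= enorm u * enorm v.
Proof.
have [->|u0] := eqVneq u 0.
  have -> : (0 : 'cV[R]_m) = 0 *: 0 by rewrite scale0r.
  by rewrite dotZl enormZ normr0 !mul0r.
have [->|v0] := eqVneq v 0.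
  have -> : (0 : 'cV[R]_m) = 0 *: 0 by rewrite scale0r.
  by rewrite dotZr enormZ normr0 !mul0r mulr0.
have uv0 : 0 < enorm u * enorm v.
  by rewrite mulr_gt0// lt_def enorm_ge0 enorm_eq0 ?u0 ?v0.
have := dot_ge0 (enorm v *: u + (- enorm u) *: v).
rewrite dotDl !dotDr !dotZl !dotZr (dotC v u) -!enorm_sqr => h.
rewrite -(ler_pM2l uv0); nra.
Qed.

Lemma enormD u v : enorm (u + v) <= enorm u + enorm v.
Proof.
rewrite -(ler_pXn2r (n := 2)) ?nnegrE ?addr_ge0 ?enorm_ge0//.
rewrite enorm_sqr dotDl !dotDr (dotC v u) -!enorm_sqr.
have := dot_le_enorm u v; nra.
Qed.

End EuclideanNorm.

(** * Tangent cones of convex sets and their images under [A] *)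

Section Cones.
Variables (R : realType) (m n : nat).
Implicit Types (X : set 'cV[R]_n) (x y z d e : 'cV[R]_n).

Definition convex_subset X :=
  forall x y (t : R), X x -> X y -> 0 <= t <= 1 -> X (x + t *: (y - x)).

Lemma polyhedron_convex X : polyhedron X -> convex_subset X.
Proof.
move=> [p [G [h ->]]] x y t /= Gx Gy t01 i.
rewrite mulmxDr -scalemxAr mulmxBr !mxE.
have := Gx i; have := Gy i; rewrite !mxE; nra.
Qed.

Variable X : set 'cV[R]_n.
Hypothesis cX : convex_subset X.

Lemma tangent_coneP x d : X x -> tangent_cone X x d ->
  exists2 t : R, 0 < t & forall s, 0 <= s <= t -> X (x + s *: d).
Proof.
move=> Xx [t t0 Xt]; exists t => // s st.
have := cX (t := s / t) Xx Xt.
rewrite addrAC subrr add0r scalerA divfK ?gt_eqF//; apply.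
have /andP[s0 st'] := st.
by rewrite divr_ge0 ?(ltW t0)//= ler_pdivrMr// mul1r.
Qed.

Lemma tangent_cone_sub x y : X y -> tangent_cone X x (y - x).
Proof. by move=> Xy; exists 1 => //; rewrite scale1r addrC subrK. Qed.

Lemma tangent_coneZ x d (a : R) :
  X x -> 0 <= a -> tangent_cone X x d -> tangent_cone X x (a *: d).
Proof.
move=> Xx; rewrite le_eqVlt => /orP[/eqP <- _|a0 [t t0 Xt]].
  by exists 1 => //; rewrite scale0r scaler0 addr0.
by exists (t / a); rewrite ?divr_gt0// scalerA divfK ?gt_eqF.
Qed.

Lemma tangent_coneD x d e :
  X x -> tangent_cone X x d -> tangent_cone X x e -> tangent_cone X x (d + e).
Proof.
move=> Xx /(tangent_coneP Xx)[t t0 Xt] /(tangent_coneP Xx)[s s0 Xs].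
pose r := Num.min t s; have r0 : 0 < r by rewrite lt_min t0.
exists (r / 2); first lra.
have Xr : X (x + r *: d) by apply: Xt; rewrite (ltW r0) ge_min lexx.
have Xr' : X (x + r *: e) by apply: Xs; rewrite (ltW r0) ge_min lexx orbT.
have := cX (t := 2^-1) Xr Xr'; rewrite (_ : _ + _ *: _ = x + (r / 2) *: (d + e)).
  by apply; lra.
by apply/colP => i; rewrite !mxE; field.
Qed.

(* The homothety of ratio 1 - t centred at y maps X into itself. *)
Lemma tangent_cone_segment x y (t : R) : X x -> X y -> 0 <= t < 1 ->
  tangent_cone X x `<=` tangent_cone X (x + t *: (y - x)).
Proof.
move=> Xx Xy t01 d [s s0 Xs]; exists ((1 - t) * s); first nra.
have := cX (t := t) Xs Xy; rewrite (_ : _ + _ *: _ =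
  x + t *: (y - x) + ((1 - t) * s) *: d).
  by apply; lra.
by apply/colP => i; rewrite !mxE; ring.
Qed.

Variable A : 'M[R]_(m, n).

Definition linear_at x := submod_closed (mem (mximage A (tangent_cone X x))).

(** The image of the tangent cone is a convex cone, hence a subspace once it contains its negatives.
    Tangent vectors are positive multiples of differences [y - x], so it suffices to negate
    these. *)
Lemma linear_atP x : X x -> linear_at x <->
  forall y, X y -> mximage A (tangent_cone X x) (A *m (x - y)).
Proof.
move=> Xx; split=> [[A0 Alin] y Xy|h].
  have : A *m (y - x) \in mximage A (tangent_cone X x).
    by apply/mem_set; exists (y - x) => //; exact: tangent_cone_sub.
  move=> /Alin-/(_ (-1) 0 A0); rewrite addr0 scaleN1r -mulmxN opprB.
  by move/set_mem.
have opp d : tangent_cone X x d ->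
    exists2 e, tangent_cone X x e & A *m e = - (A *m d).
  move=> [t t0 /h[e Te eAe]]; exists (t^-1 *: e).
    by apply: tangent_coneZ => //; rewrite invr_ge0 ltW.
  rewrite -scalemxAr eAe opprD addrA subrr sub0r mulmxN -scalemxAr scalerN.
  by rewrite scalerA mulVf ?gt_eqF// scale1r.
split.
  apply/mem_set; exists 0; last by rewrite mulmx0.
  by rewrite -[0](subrr x); exact: tangent_cone_sub.
move=> a u v /set_mem[d Td <-] /set_mem[e Te <-]; apply/mem_set.
have [a0|a0] := leP 0 a.
  exists (a *: d + e); last by rewrite mulmxDr -scalemxAr.
  by apply: tangent_coneD => //; exact: tangent_coneZ.
have [d' Td' Ad'] := opp _ Td.
exists (- a *: d' + e); last by rewrite mulmxDr -scalemxAr Ad' scalerN scaleNr opprK.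
by apply: tangent_coneD => //; apply: tangent_coneZ => //; lra.
Qed.

Lemma linear_at_sub x y z : X x -> X y -> X z -> linear_at x ->
  mximage A (tangent_cone X x) (A *m (y - z)).
Proof.
move=> Xx Xy Xz Lx.
have [d Td Ad] := (linear_atP Xx).1 Lx _ Xz.
exists ((y - x) + d); last by rewrite mulmxDr Ad -mulmxDr addrA subrK.
by apply: tangent_coneD => //; exact: tangent_cone_sub.
Qed.

(* A point of the relative interior of A(X) stays there when moved towards a
   point of A(X). *)
Lemma linear_at_segment x y z (t : R) : X x -> X y -> X z -> 0 <= t < 1 ->
  A *m z = A *m (x + t *: (y - x)) -> linear_at x -> linear_at z.
Proof.
move=> Xx Xy Xz t01 Az /(linear_atP Xx) Lx; apply/(linear_atP Xz) => w Xw.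
have [d [s s0 Xs] Ad] := Lx _ Xw.
have t1 : 0 < 1 - t by lra.
pose y' := x + s *: d + t *: (y - (x + s *: d)).
have Xy' : X y' by apply: cX => //; lra.
(* Modulo the kernel of [A], [y' - z] is [((1 - t) * s) *: (x - w)] and [y - z] is
   [(1 - t) *: (y - x)], so the two terms give [x - w] and [z - x]. *)
exists (((1 - t) * s)^-1 *: (y' - z) + (t / (1 - t)) *: (y - z)).
  apply: tangent_coneD => //; apply: tangent_coneZ => //.
  - by rewrite invr_ge0 mulr_ge0 ?ltW.
  - exact: tangent_cone_sub.
  - by rewrite divr_ge0 ?(ltW t1)//; lra.
  - exact: tangent_cone_sub.
rewrite !(mulmxDr, mulmxN) -!scalemxAr !(mulmxDr, mulmxN) Az.
rewrite !(mulmxDr, mulmxN) -!scalemxAr !(mulmxDr, mulmxN) -!scalemxAr Ad.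
rewrite mulmxDr mulmxN; apply/colP => i; rewrite !mxE; field.
by rewrite !gt_eqF.
Qed.

End Cones.

(** * Extremal members of finite families *)

Section FiniteFamilies.
Variables (J : finType) (P : J -> Prop).

(** Among the admissible [j] with [F j] inside [F j0], take one minimising the number of indices [k]
    with [F k] inside [F j]. *)
Lemma finite_minimal_subset (T : Type) (F : J -> set T) (j0 : J) : P j0 ->
  exists2 j, P j /\ F j `<=` F j0 & forall k, P k -> F k `<=` F j -> F k = F j.
Proof.
move=> P0; pose below j := [set k | `[<F k `<=` F j>]]%SET.
pose Q j := `[<P j /\ F j `<=` F j0>].
have Q0 : Q j0 by apply/asboolP; split.
case: (arg_minnP (fun j => #|below j|) Q0) => j /asboolP[Pj Fj] jmin.
exists j => // k Pk Fkj; apply/seteqP; split=> //.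
have bkj : below k \subset below j.
  by apply/fintype.subsetP => l; rewrite !inE => Flk t /Flk/Fkj.
have cjk : (#|below j| <= #|below k|)%N.
  by apply: jmin; apply/asboolP; split=> // t /Fkj/Fj.
have /eqP bE : below k == below j by rewrite eqEcard bkj cjk.
have : j \in below k by rewrite bE inE; apply/asboolP.
by rewrite inE => /asboolP.
Qed.

Lemma finite_max (d : Order.disp_t) (T : orderType d) (g : J -> T) (j0 : J) :
  P j0 -> exists2 j, P j & forall k, P k -> (g k <= g j)%O.
Proof.
move=> P0; pose Q j := `[<P j>]; have Q0 : Q j0 by apply/asboolP.
case: (arg_maxP g Q0) => j /asboolP Pj jmax; exists j => // k Pk.
by apply: jmax; apply/asboolP.
Qed.

End FiniteFamilies.

(** * Tangent cones of polyhedra *)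

Section PolyhedralCones.
Variables (R : realType) (p n : nat) (G : 'M[R]_(p, n)) (h : 'cV[R]_p).

Definition active_cone (I : {set 'I_p}) : set 'cV[R]_n :=
  [set d | forall i, i \in I -> (G *m d) i 0 <= 0].

Lemma tangent_cone_polyhedron (x : 'cV[R]_n) :
  let X := [set z : 'cV[R]_n | forall i, (G *m z) i 0 <= h i 0] in
  X x -> tangent_cone X x =
    active_cone [set i | (G *m x) i 0 == h i 0].
Proof.
have lin d t i : (G *m (x + t *: d)) i 0 = (G *m x) i 0 + t * (G *m d) i 0.
  by rewrite mulmxDr -scalemxAr [LHS]mxE [X in _ + X]mxE.
move=> X Xx; apply/seteqP; split=> d.
  move=> [t t0 Xt] i; rewrite inE => /eqP xi; move: (Xt i).
  by rewrite lin xi gerDl pmulr_rle0.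
(* [slack i] is a step length that an inactive constraint tolerates. The summand 1 avoids division
   by zero; the default 1 of the minimum keeps [t] positive when all constraints are active. *)
move=> Id; pose slack i := (h i 0 - (G *m x) i 0) / (1 + `|(G *m d) i 0|).
pose t := \big[Num.min/1]_(i | (G *m x) i 0 != h i 0) slack i.
have t0 : 0 < t.
  rewrite lt_bigmin// => i xi; apply: divr_gt0; last by rewrite ltr_pwDl.
  by rewrite subr_gt0 lt_neqAle xi; exact: Xx.
exists t => // i; rewrite lin.
have := Xx i; have [xi _|xi _] := eqVneq ((G *m x) i 0) (h i 0).
  by rewrite xi gerDl pmulr_rle0//; apply: Id; rewrite inE xi.
rewrite -lerBrDl.
have ti : t <= slack i by exact: bigmin_le_cond.
apply: le_trans (_ : t * (1 + `|(G *m d) i 0|) <= _).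
  by rewrite ler_pM2l// (le_trans (ler_norm _))// lerDr.
by rewrite -ler_pdivlMr// ltr_pwDl.
Qed.

End PolyhedralCones.

(** The set of active constraints determines the tangent cone, and there are finitely many such
    sets. *)
Lemma finite_tangent_cones (R : realType) (n : nat) (X : set 'cV[R]_n) :
  polyhedron X -> exists (J : finType) (F : J -> set 'cV[R]_n),
    forall x, X x -> exists j, tangent_cone X x = F j.
Proof.
move=> [p [G [h ->]]]; exists {set 'I_p}, (active_cone G) => x Xx.
by eexists; exact: tangent_cone_polyhedron.
Qed.

(** * Topology of column vectors and arbitrary norms *)

Section ColumnTopology.
Variables (R : realType) (n : nat).

Lemma mulmx_coord_continuous (m : nat) (G : 'M[R]_(m, n)) (i : 'I_m) :
  continuous (fun z : 'cV[R]_n => (G *m z) i 0).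
Proof.
have -> : (fun z : 'cV[R]_n => (G *m z) i 0) =
    (fun z : 'cV[R]_n => \sum_j G i j * z j 0).
  by apply/funext => z; rewrite mxE.
apply: continuous_big => [|j _ z]; first exact: add_continuous.
exact: (cvgM (cvg_cst _) (@coord_continuous R n 1 j 0 z)).
Qed.

Lemma polyhedron_closed (X : set 'cV[R]_n) : polyhedron X -> closed X.
Proof.
move=> [p [G [h ->]]].
rewrite (_ : mkset _ = \bigcap_(i in setT)
  ((fun z : 'cV[R]_n => (G *m z) i 0) @^-1` [set r | r <= h i 0])); last first.
  by apply/seteqP; split=> z Xz i; [move=> _|]; exact: Xz.
apply: closed_bigI => i _; apply: preimage_closed; last exact: closed_le.
by move=> z _; exact: mulmx_coord_continuous.
Qed.

(** Compactness of a box of row vectors is carried to columns by transposition. *)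
Lemma cV_bounded_closed_compact (B : set 'cV[R]_n) (M : R) :
  (forall v, B v -> `|v| <= M) -> closed B -> compact B.
Proof.
move=> BM cB.
have trc : continuous (trmx : 'rV[R]_n -> 'cV[R]_n).
  move=> /= r s /nbhs_ballP[e e0 es]; apply/nbhs_ballP; exists e => //= r'.
  by move=> [_ rr']; apply: es; split=> // i j; rewrite !mxE; exact: rr'.
pose box := [set r : 'rV[R]_n | forall i, `[-M, M]%classic (r 0 i)].
have cbox : compact box.
  by apply: (@rV_compact _ _ (fun=> `[-M, M]%classic)) => i; exact: segment_compact.
apply: (subclosed_compact cB (B := trmx @` box)).
  by apply: continuous_compact => //; exact: continuous_subspaceT.
move=> v Bv; exists v^T; last by rewrite trmxK.
move=> i; rewrite /= in_itv/= mxE -ler_norml; apply: le_trans (BM _ Bv).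
rewrite [leRHS]/Num.norm /= mx_normrE; apply/bigmax_geP; right.
by exists (i, 0).
Qed.

Section Norm.
Variable N : 'cV[R]_n -> R.
Hypothesis hN : is_norm N.

Lemma is_norm0 : N 0 = 0.
Proof. by case: hN => _ NZ _; rewrite -(scale0r 0) NZ normr0 mul0r. Qed.

Lemma is_normN x : N (- x) = N x.
Proof. by case: hN => _ NZ _; rewrite -scaleN1r NZ normrN1 mul1r. Qed.

Lemma is_norm_ge0 x : 0 <= N x.
Proof.
case: (hN) => _ _ ND; have := ND x (- x).
by rewrite subrr is_norm0 is_normN; lra.
Qed.

(** Expanding in the standard basis bounds [N (z - x)] by the weighted coordinate sum [S z], which
    tends to 0. *)
Lemma is_norm_continuous : continuous N.
Proof.
case: (hN) => _ NZ ND.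
move=> x; pose S (z : 'cV[R]_n) := \sum_i `|z i 0 - x i 0| * N (delta_mx i 0).
have NS z : N (z - x) <= S z.
  have {1}-> : z - x = \sum_i (z i 0 - x i 0) *: delta_mx i 0.
    apply/colP => i; rewrite summxE (bigD1 i)//= !mxE !eqxx mulr1.
    rewrite big1 ?addr0// => j ji; rewrite !mxE [i == j]eq_sym (negPf ji).
    by rewrite mulr0.
  rewrite /S; elim/big_ind2 : _ => [|? ? ? ? le1 le2|i _].
  - by rewrite is_norm0.
  - by apply: le_trans (ND _ _) _; exact: lerD.
  - by rewrite NZ.
have Sc : continuous S.
  apply: continuous_big => [|j _ z]; first exact: add_continuous.
  have cz : y j 0 @[y --> z] --> z j 0 := @coord_continuous R n 1 j 0 z.
  exact: (cvgM (cvg_norm (cvgB cz (cvg_cst _))) (cvg_cst _)).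
have Sx : S x = 0 by rewrite /S big1// => i _; rewrite subrr normr0 mul0r.
apply/(@cvgrPdist_lt _ _ _ (nbhs x)) => e e0; near=> z.
have Sz : `|S x - S z| < e.
  by near: z; apply: (@cvgr_dist_lt _ _ _ (nbhs x)) => //; exact: Sc.
rewrite Sx sub0r normrN in Sz; apply: le_lt_trans (le_lt_trans (ler_norm _) Sz).
have := ND (x - z) z; have := ND (z - x) x; have := NS z.
rewrite !subrK -(is_normN (x - z)) opprB ler_norml => NSz NDz NDx.
by apply/andP; split; lra.
Unshelve. all: by end_near. Qed.

(** The constant is the inverse of the minimum of [N] on the compact unit sphere of the sup norm. It
    turns bounds on [N] into the boundedness that compactness requires. *)
Lemma is_norm_equiv : exists2 c : R, 0 < c & forall x, `|x| <= c * N x.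
Proof.
case: (hN) => N0 NZ ND.
pose S := [set x : 'cV[R]_n | `|x| = 1].
(* An empty sphere leaves 0 as the only vector. *)
have [[x0 Sx0]|S0] := pselect (S !=set0); last first.
  exists 1 => // x; have [->|x0] := eqVneq x 0.
    by rewrite normr0 is_norm0 mulr0.
  case: S0; exists (`|x|^-1 *: x).
  by rewrite /S/= normrZ normfV normr_id mulVf// normr_eq0.
have cS : compact S.
  apply: (@cV_bounded_closed_compact _ 1) => [v -> //|].
  apply: (preimage_closed (f := fun x : 'cV[R]_n => `|x|) _ (@closed_eq R 1)).
  by move=> v _; exact: norm_continuous.
have [c /set_mem Sc cmin] := compact_EVT_min (ex_intro _ _ Sx0) cS
  (continuous_subspaceT is_norm_continuous).
have Nc : 0 < N c.
  rewrite lt_def is_norm_ge0 andbT; apply/eqP => /N0 c0.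
  by move: Sc; rewrite /S/= c0 normr0 => /eqP; rewrite eq_sym oner_eq0.
exists (N c)^-1; first by rewrite invr_gt0.
move=> x; have [->|x0'] := eqVneq x 0; first by rewrite normr0 is_norm0 mulr0.
have xn : 0 < `|x| by rewrite normr_gt0.
rewrite ler_pdivlMl//.
have : N c <= N (`|x|^-1 *: x).
  by apply: cmin; apply/mem_set; rewrite /S/= normrZ normfV normr_id mulVf ?gt_eqF.
by rewrite NZ normfV normr_id ler_pdivlMl// mulrC.
Qed.

End Norm.

End ColumnTopology.

(** * Lifting segments and the error bound *)

Section ErrorBound.
Variables (R : realType) (m n : nat) (A : 'M[R]_(m, n)).
Variables (N : 'cV[R]_n -> R) (X : set 'cV[R]_n).
Hypothesis hN : is_norm N.

(* Among the points of X lying above the segment [A x, A x + v] and at distance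
   at most c times the fraction covered, one covers a maximal fraction. *)
Lemma lift_segment (x : 'cV[R]_n) (v : 'cV[R]_m) (c : R) :
  convex_subset X -> closed X -> X x -> v != 0 ->
  (forall z s, X z -> 0 <= s < 1 -> A *m z = A *m x + s *: v ->
     exists2 d, tangent_cone X z d & A *m d = v /\ N d <= c) ->
  exists2 z, X z & A *m z = A *m x + v /\ N (z - x) <= c.
Proof.
move=> cX clX Xx v0 step.
have [N0 NZ ND] := hN.
have v2 : dot v v != 0 by rewrite dot_eq0.
(* The fraction of the segment covered by [z], read off by projecting on [v]. *)
pose s (z : 'cV[R]_n) := dot (A *m z - A *m x) v / dot v v.
have sE z t : A *m z = A *m x + t *: v -> s z = t.
  by move=> Az; rewrite /s Az addrAC subrr add0r dotZl mulfK.
have cA i : continuous (fun z : 'cV[R]_n => (A *m z - A *m x) i 0).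
  have -> : (fun z : 'cV[R]_n => (A *m z - A *m x) i 0) =
      (fun z : 'cV[R]_n => (A *m z) i 0 - (A *m x) i 0).
    by apply/funext => z; rewrite [LHS]mxE [X in _ + X]mxE.
  move=> z; have cz : (A *m y) i 0 @[y --> z] --> (A *m z) i 0.
    exact: mulmx_coord_continuous.
  exact: (cvgB cz (cvg_cst _)).
have cs : continuous s.
  have cd : continuous (fun z : 'cV[R]_n => dot (A *m z - A *m x) v).
    apply: continuous_big => [|i _ y]; first exact: add_continuous.
    have ci : (A *m y' - A *m x) i 0 @[y' --> y] --> (A *m y - A *m x) i 0.
      exact: cA.
    exact: (cvgM ci (cvg_cst _)).
  by move=> z; exact: (cvgM (cd z) (cvg_cst _)).
have cNx : continuous (fun z : 'cV[R]_n => N (z - x) - c * s z).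
  have cN : continuous (fun z : 'cV[R]_n => N (z - x)).
    have csub : continuous (fun z : 'cV[R]_n => z - x).
      move=> z; apply: (@cvgB R 'cV[R]_n _ (nbhs z)); [exact: cvg_id|].
      exact: cvg_cst.
    by move=> z; apply: continuous_comp (csub z) _; exact: is_norm_continuous.
  by move=> z; exact: (cvgB (cN z) (cvgM (cvg_cst _) (cs z))).
(* Written as an intersection of preimages, [K] is visibly closed; [KP] gives the readable form. *)
pose K := X `&` s @^-1` [set r | 0 <= r] `&` s @^-1` [set r | r <= 1]
  `&` (fun z : 'cV[R]_n => N (z - x) - c * s z) @^-1` [set r | r <= 0]
  `&` \bigcap_(i in setT)
     (fun z : 'cV[R]_n => (A *m z - A *m x) i 0 - s z * v i 0) @^-1` [set r | r = 0].
have KP z : K z <-> [/\ X z, 0 <= s z, s z <= 1, N (z - x) <= c * s z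
    & A *m z = A *m x + s z *: v].
  rewrite /K; split.
    move=> [[[[Xz s0] s1] Nz] Az]; split=> //; first by rewrite -subr_le0.
    apply/eqP; rewrite addrC -subr_eq; apply/eqP/colP => i.
    by apply/eqP; rewrite [X in _ == X]mxE -subr_eq0; apply/eqP; exact: Az.
  move=> [Xz s0 s1 Nz Az]; do ![split=> //]; first by rewrite /= subr_le0.
  by move=> i _ /=; rewrite Az addrAC subrr add0r mxE subrr.
have clK : closed K.
  repeat apply: closedI => //.
  - by apply: preimage_closed; [move=> z _; exact: cs|exact: closed_ge].
  - by apply: preimage_closed; [move=> z _; exact: cs|exact: closed_le].
  - by apply: preimage_closed; [move=> z _; exact: cNx|exact: closed_le].
  apply: closed_bigI => i _; apply: preimage_closed; last exact: closed_eq.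
  by move=> z _; exact: (cvgB (cA i z) (cvgM (cs z) (cvg_cst _))).
have sx : s x = 0 by apply: sE; rewrite scale0r addr0.
have c0 : 0 <= c.
  have s0 : A *m x = A *m x + 0 *: v by rewrite scale0r addr0.
  have [|d _ [_ Nd]] := step x 0 Xx _ s0; first by rewrite lexx ltr01.
  exact: le_trans (is_norm_ge0 hN d) Nd.
have Kx : K x.
  by apply/KP; split; rewrite ?sx ?ler01// ?subrr ?is_norm0 ?mulr0// scale0r addr0.
have [k k0 kN] := is_norm_equiv hN.
have cK : compact K.
  apply: (@cV_bounded_closed_compact _ _ _ (`|x| + k * c)) => // z.
  move=> /KP[_ _ s1 Nz _]; rewrite -[z](subrK x) addrC.
  apply: le_trans (ler_normD _ _) _; rewrite lerD2l.
  apply: le_trans (kN _) _; rewrite ler_pM2l//; apply: le_trans Nz _.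
  by rewrite ler_piMr.
have [z /set_mem/KP[Xz s0 s1 Nz Az] zmax] :=
  compact_EVT_max (ex_intro _ _ Kx) cK (continuous_subspaceT cs).
have [s1'|s1'] := ltP (s z) 1; last first.
  have sz : s z = 1 by apply/eqP; rewrite eq_le s1.
  by exists z => //; rewrite Az sz scale1r; split=> //; rewrite -[c]mulr1 -sz.
have s01 : 0 <= s z < 1 by rewrite s0.
(* A maximiser short of the end could still be moved by [r *: d] inside [K], which contradicts
   maximality. *)
have [d /(tangent_coneP cX Xz)[t t0 Xt] [Ad Nd]] := step _ _ Xz s01 Az.
pose r := Num.min t (1 - s z).
have r0 : 0 < r by rewrite lt_min t0 subr_gt0.
have Azr : A *m (z + r *: d) = A *m x + (s z + r) *: v.
  by rewrite mulmxDr -scalemxAr Ad Az scalerDl addrA.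
have : K (z + r *: d).
  apply/KP; rewrite (sE _ _ Azr); split=> //.
  - by apply: Xt; rewrite (ltW r0) ge_min lexx.
  - by rewrite addr_ge0// ltW.
  - by rewrite -lerBrDl ge_min lexx orbT.
  - rewrite addrAC; apply: le_trans (ND _ _) _.
    by rewrite mulrDr lerD// NZ gtr0_norm// mulrC ler_pM2r.
by move=> /mem_set/zmax; rewrite (sE _ _ Azr) gerDl leNgt r0.
Qed.

(** Since [solve] applies only above the relative interior, the lift starts at a nearby point [xe]
    instead of [x]; the strict inequality on [r] pays for the displacement. *)
Lemma error_bound (M : R) (x0 : 'cV[R]_n) :
  convex_subset X -> closed X -> X x0 -> linear_at X A x0 -> 0 <= M ->
  (forall z x y (M' : R), X z -> linear_at X A z -> X x -> X y -> M < M' ->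
     exists2 d, tangent_cone X z d &
       A *m d = A *m (y - x) /\ N d <= M' * enorm (A *m (y - x))) ->
  forall x y (r : R), X x -> X y -> M * enorm (A *m (y - x)) < r ->
  exists2 z, X z & A *m z = A *m y /\ N (z - x) <= r.
Proof.
move=> cX clX Xx0 Lx0 M0 solve x y r Xx Xy rM.
have [N0 NZ ND] := hN.
set a := enorm _ in rM.
pose b := enorm (A *m (x - x0)); pose k := N (x0 - x).
have a0 : 0 <= a := enorm_ge0 _.
have b0 : 0 <= b := enorm_ge0 _.
have k0 : 0 <= k := is_norm_ge0 hN _.
(* For [e <= 1], [(M + e) * (a + e * b) + e * k <= M * a + e * q]; the summand 1 makes [q]
   positive. *)
pose q := 1 + a + M * b + b + k.
have q0 : 0 < q by have := mulr_ge0 M0 b0; rewrite /q; lra.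
pose e := Num.min 1 ((r - M * a) / q).
have e0 : 0 < e by rewrite lt_min ltr01 divr_gt0// subr_gt0.
have e1 : e <= 1 by rewrite ge_min lexx.
have eq : e * q <= r - M * a by rewrite -ler_pdivlMr// ge_min lexx orbT.
pose xe := x0 + (1 - e) *: (x - x0).
have Xxe : X xe by apply: cX => //; lra.
have Lxe : linear_at X A xe.
  by apply: (linear_at_segment cX Xx0 Xx Xxe (t := 1 - e)) => //; lra.
pose v := A *m (y - xe).
have va : enorm v <= a + e * b.
  rewrite /v (_ : y - xe = (y - x) + e *: (x - x0)).
    rewrite mulmxDr -scalemxAr; apply: le_trans (enormD _ _) _.
    by rewrite enormZ gtr0_norm.
  by apply/colP => i; rewrite !mxE; ring.
have xex : N (xe - x) <= e * k.
  rewrite (_ : xe - x = e *: (x0 - x)) ?NZ ?gtr0_norm//.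
  by apply/colP => i; rewrite !mxE; ring.
have bound z : N (z - xe) <= (M + e) * enorm v -> N (z - x) <= r.
  move=> Nz; rewrite -[z](subrK xe) -addrA; apply: le_trans (ND _ _) _.
  have Me : 0 <= M + e by lra.
  have Mv := ler_wpM2l Me va.
  have ee : e * (e * b) <= e * b by rewrite ler_piMl// mulr_ge0// ltW.
  rewrite (_ : (M + e) * (a + e * b) =
    M * a + e * (a + M * b) + e * (e * b)) in Mv; last by ring.
  rewrite (_ : e * q = e + e * (a + M * b) + e * b + e * k) in eq.
    by lra.
  by rewrite /q; ring.
have [v0|v0] := eqVneq v 0.
  exists xe => //; split.
    by apply/eqP; rewrite eq_sym -subr_eq0 -mulmxBr; apply/eqP.
  by apply: bound; rewrite subrr is_norm0// mulr_ge0 ?enorm_ge0 ?addr_ge0 ?(ltW e0).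
have [|z Xz [Az Nz]] := lift_segment (c := (M + e) * enorm v) cX clX Xxe v0.
  move=> z s Xz s01 Az; apply: solve => //; last lra.
  apply: (linear_at_segment cX Xxe Xy Xz s01 _ Lxe).
  by rewrite Az (mulmxDr A xe) -scalemxAr.
exists z => //; split; last exact: bound.
by rewrite Az /v mulmxBr addrC subrK.
Qed.

End ErrorBound.

(** * Gradient and Bregman distance of the least squares function *)

Section LeastSquares.
Variables (R : realType) (m n : nat) (A : 'M[R]_(m, n)) (b : 'cV[R]_m).
Variable f : 'cV[R]_n -> R.
Hypothesis hf : forall x, f x = 2^-1 * enorm (A *m x - b) ^+ 2.

(** The exact second-order expansion, from which the derivative and the Bregman distance are both
    read off. *)
Lemma lsq_expand (x v : 'cV[R]_n) (t : R) : f (x + t *: v) - f x =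
  t * dot (A *m x - b) (A *m v) + t ^+ 2 * (2^-1 * dot (A *m v) (A *m v)).
Proof.
rewrite !hf !enorm_sqr mulmxDr -scalemxAr addrAC.
move: (A *m x - b) => w.
by rewrite dotDl !dotDr !dotZl !dotZr (dotC (A *m v)); field.
Qed.

Lemma lsq_derive (x v : 'cV[R]_n) : 'D_v f x = dot (A *m x - b) (A *m v).
Proof.
apply: cvg_lim => //.
(* The difference quotient at [h] is exactly [c + h * k]. *)
set c := dot _ _; pose k : R := 2^-1 * dot (A *m v) (A *m v).
have ck : (fun h : R => c + h * k) h @[h --> 0^'] --> c.
  have ck0 : (fun h : R => c + h * k) h @[h --> (0 : R)] --> c + 0 * k.
    exact: (cvgD (cvg_cst _) (cvgM cvg_id (cvg_cst _))).
  rewrite mul0r addr0 in ck0; exact: cvg_within_filter ck0.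
apply: cvg_trans ck; apply: near_eq_cvg; near=> h.
have h0 : h != 0 by near: h; exact: nbhs_dnbhs_neq.
rewrite /= [h *: v + x]addrC lsq_expand -/c -/k /GRing.scale/=.
by field.
Unshelve. all: by end_near. Qed.

Lemma lsq_grad (x u : 'cV[R]_n) :
  dot (grad f x) u = dot (A *m x - b) (A *m u).
Proof.
have -> : A *m u = \sum_i u i 0 *: (A *m delta_mx i 0).
  rewrite (eq_bigr (fun i => A *m (u i 0 *: delta_mx i 0))); last first.
    by move=> i _; rewrite scalemxAr.
  rewrite -mulmx_sumr; congr (_ *m _); apply/colP => i.
  rewrite summxE (bigD1 i)//= !mxE !eqxx mulr1 big1 ?addr0// => j ji.
  by rewrite !mxE [i == j]eq_sym (negPf ji) mulr0.
rewrite (big_morph (dot (A *m x - b)) (fun u v => dotDr u v _) (_ : _ = 0)).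
  by apply: eq_bigr => i _; rewrite mxE lsq_derive dotZr mulrC.
by rewrite -(scale0r 0) dotZr mul0r.
Qed.

Lemma lsq_bregman (y x : 'cV[R]_n) :
  bregman f y x = 2^-1 * enorm (A *m (y - x)) ^+ 2.
Proof.
rewrite /bregman lsq_grad enorm_sqr.
have := lsq_expand x (y - x) 1; rewrite scale1r (addrC x) subrK => ->.
by rewrite mul1r expr1n; ring.
Qed.

(** The gradient pairing equals the squared norm of [A *m (x - y)]; its vanishing also forces equal
    values of [f]. *)
Lemma lsq_Zset (X : set 'cV[R]_n) (y : 'cV[R]_n) :
  Zset f X y = [set x | X x /\ A *m x = A *m y].
Proof.
have gradB x : dot (grad f x - grad f y) (x - y) =
    dot (A *m (x - y)) (A *m (x - y)).
  rewrite dotDl -[- grad f y]scaleN1r dotZl !lsq_grad -dotZl -dotDl.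
  by rewrite scaleN1r opprB addrA subrK -mulmxBr.
apply/seteqP; split=> x.
  move=> [Xx [_ /eqP]]; rewrite gradB dot_eq0 mulmxBr subr_eq0 => /eqP.
  by split.
move=> [Xx Axy]; split=> //; split; first by rewrite !hf Axy.
by rewrite gradB mulmxBr Axy subrr; apply/eqP; rewrite dot_eq0.
Qed.

End LeastSquares.

(** * Norm of the inverse of [A] on a tangent cone *)

Section ConeInverseNorm.
Variables (R : realType) (m n : nat) (A : 'M[R]_(m, n)).
Variables (N : 'cV[R]_n -> R) (X : set 'cV[R]_n).
Hypothesis hN : is_norm N.

Lemma cone_inv_norm_ge0 (x : 'cV[R]_n) : X x ->
  (0 <= cone_inv_norm N A (tangent_cone X x))%E.
Proof.
move=> Xx; apply: le_trans (_ : _ <= ereal_inf _)%E _; last first.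
  apply: ereal_sup_ubound; exists 0 => //; split.
    exists 0; last by rewrite mulmx0.
    by rewrite -(subrr x); exact: tangent_cone_sub.
  have -> : (0 : 'cV[R]_m) = 0 *: 0 by rewrite scale0r.
  by rewrite enormZ normr0 mul0r ler01.
by apply: le_ereal_inf_tmp => _ [d _ <-]; rewrite lee_fin is_norm_ge0.
Qed.

(** Scaling reduces a nonzero [v] to unit length. The margin [M < M'] yields an actual preimage
    whether or not the infimum is attained. *)
Lemma cone_inv_norm_lift (x : 'cV[R]_n) (v : 'cV[R]_m) (M M' : R) :
  X x -> (cone_inv_norm N A (tangent_cone X x) <= M%:E)%E -> M < M' ->
  mximage A (tangent_cone X x) v ->
  exists2 d, tangent_cone X x d & A *m d = v /\ N d <= M' * enorm v.
Proof.
move=> Xx CM MM' [e Te Ae]; have [N0 NZ ND] := hN.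
have [v0|v0] := eqVneq v 0.
  exists 0; first by rewrite -(subrr x); exact: tangent_cone_sub.
  have /eqP -> : enorm v == 0 by rewrite enorm_eq0 v0.
  by rewrite mulmx0 v0 is_norm0// mulr0.
have a0 : 0 < enorm v by rewrite lt_def enorm_ge0 enorm_eq0 v0.
set a := enorm v in a0 *.
have : (ereal_inf [set (N d)%:E | d in
    [set d | tangent_cone X x d /\ A *m d = a^-1 *: v]] < M'%:E)%E.
  apply: le_lt_trans (_ : _ <= M%:E)%E _; last by rewrite lte_fin.
  apply: le_trans CM; apply: ereal_sup_ubound; exists (a^-1 *: v) => //; split.
    exists (a^-1 *: e); last by rewrite -scalemxAr Ae.
    by apply: tangent_coneZ => //; rewrite invr_ge0 ltW.
  by rewrite enormZ gtr0_norm ?invr_gt0// mulVf ?gt_eqF.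
move=> /ereal_inf_lt[_ [d [Td Ad] <-]]; rewrite lte_fin => NdM.
exists (a *: d); first by apply: tangent_coneZ => //; exact: ltW.
split; first by rewrite -scalemxAr Ad scalerA divff ?gt_eqF// scale1r.
by rewrite NZ gtr0_norm// mulrC ler_pM2r// ltW.
Qed.

End ConeInverseNorm.

(** * Admissible moduli, cone norms and error bounds *)

Section RelativeConstant.
Variables (R : realType) (m n : nat) (N : 'cV[R]_n -> R).
Variables (A : 'M[R]_(m, n)) (b : 'cV[R]_m) (X : set 'cV[R]_n).
Variables (f : 'cV[R]_n -> R) (D : 'cV[R]_n -> 'cV[R]_n -> R).
Hypothesis hN : is_norm N.
Hypothesis hD : forall x y, D x y = 2^-1 * N (x - y) ^+ 2.
Hypothesis hf : forall x, f x = 2^-1 * enorm (A *m x - b) ^+ 2.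

Definition is_modulus (mu : R) := 0 <= mu /\
  forall x y, X x -> X y ->
    (mu%:E * set_dist D (Zset f X y) x
      <= set_dist (bregman f) (Zset f X y) x)%E.

(** [A] is constant on [Zset f X y], so the infimum runs over a single value. *)
Lemma set_dist_bregman (x y : 'cV[R]_n) : X y ->
  set_dist (bregman f) (Zset f X y) x
    = (2^-1 * enorm (A *m (y - x)) ^+ 2)%:E.
Proof.
move=> Xy; apply/eqP; rewrite eq_le; apply/andP; split.
  apply: ereal_inf_lbound; exists y; first by rewrite (lsq_Zset hf).
  by rewrite (lsq_bregman hf).
apply: le_ereal_inf_tmp => _ [z + <-].
by rewrite (lsq_Zset hf) => -[Xz Az]; rewrite (lsq_bregman hf) !mulmxBr Az.
Qed.

Lemma set_dist_real (x y : 'cV[R]_n) : X y ->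
  exists2 r : R, 0 <= r & set_dist D (Zset f X y) x = r%:E.
Proof.
move=> Xy.
have ge0 : (0 <= set_dist D (Zset f X y) x)%E.
  apply: le_ereal_inf_tmp => _ [z _ <-].
  by rewrite hD lee_fin mulr_ge0// sqr_ge0.
have lty : (set_dist D (Zset f X y) x <= (D y x)%:E)%E.
  by apply: ereal_inf_lbound; exists y => //; rewrite (lsq_Zset hf).
case: (set_dist _ _ _) ge0 lty => [r||//]; last by rewrite leye_eq.
by rewrite lee_fin => r0 _; exists r.
Qed.

(* If x + t d is in X, a point z of Z(x + t d) nearly closest to x has z - x in the tangent
   cone at x, so (z - x) / t is a short preimage of A d. *)
Lemma modulus_le_cone (mu : R) (x : 'cV[R]_n) : X x -> is_modulus mu ->
  (mu%:E <= (cone_inv_norm N A (tangent_cone X x) ^+ 2)^-1)%E.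
Proof.
move=> Xx [mu0 mod]; have [N0 NZ ND] := hN.
have C0 := cone_inv_norm_ge0 A hN Xx.
have [->|munz] := eqVneq mu 0.
  by rewrite inve_ge0 expe_ge0.
have {}mu0 : 0 < mu by rewrite lt_def munz.
(* The strict margin over [mu^-1] makes room for a point that is only nearly closest. *)
suff le : forall r : R, 0 < r -> mu^-1 < r ^+ 2 ->
    (cone_inv_norm N A (tangent_cone X x) <= r%:E)%E.
  have [r0 rE] : exists r0 : R, cone_inv_norm N A (tangent_cone X x) = r0%:E.
    have := le (mu^-1 + 1); case: (cone_inv_norm _ _ _) C0 => [r0 _ _||//].
      by exists r0.
    have mui : 0 < mu^-1 by rewrite invr_gt0.
    by move=> _ h; have := h ltac:(lra) ltac:(nra); rewrite leye_eq.
  rewrite rE lee_fin in C0; rewrite rE -EFin_expe inver.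
  case: eqP => [_|/eqP r0nz]; first exact: leey.
  have {r0nz}C0 : 0 < r0 by move: r0nz; rewrite sqrf_eq0 lt_def C0 andbT.
  rewrite lee_fin leNgt; apply/negP => lt_mu.
  (* [q < r0] have product [mu^-1], so their mean has square above [mu^-1] yet lies below [r0],
     against [le]. *)
  pose q := mu^-1 / r0; have q0 : 0 < q by rewrite divr_gt0// invr_gt0.
  have mE : mu^-1 = q * r0 by rewrite divfK ?gt_eqF.
  have qr : q < r0.
    rewrite ltr_pdivrMr// -expr2 -[ltRHS]invrK ltf_pV2 ?posrE//.
    by rewrite invr_gt0 exprn_gt0.
  have := le ((r0 + q) / 2); rewrite rE lee_fin mE => h.
  have := h ltac:(lra) ltac:(nra); lra.
move=> r r0 mur; apply: ge_ereal_sup => _ [v [[d [t t0 Xt] Ad] v1] <-].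
set y := x + t *: d in Xt.
have [s s0 sE] := set_dist_real x Xt.
have yx : A *m (y - x) = t *: v by rewrite /y addrAC subrr add0r -scalemxAr Ad.
have := mod _ _ Xx Xt; rewrite sE set_dist_bregman// -EFinM lee_fin yx enormZ.
rewrite gtr0_norm// exprMn => sle.
have : (set_dist D (Zset f X y) x < (2^-1 * (t * r) ^+ 2)%:E)%E.
  rewrite sE lte_fin -(ltr_pM2l mu0); apply: le_lt_trans sle _.
  have v2 : enorm v ^+ 2 <= 1 by rewrite expr_le1// enorm_ge0.
  have rm : 1 < mu * r ^+ 2 by rewrite -ltr_pdivrMl// mulr1.
  have t2 : 0 < t ^+ 2 by rewrite exprn_gt0.
  apply: le_lt_trans (_ : 2^-1 * t ^+ 2 * 1 < _).
    by rewrite -mulrA ler_pM2l// ler_pM2l.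
  rewrite (_ : mu * _ = 2^-1 * t ^+ 2 * (mu * r ^+ 2)); last by ring.
  by rewrite ltr_pM2l// mulr_gt0.
move=> /ereal_inf_lt[_ [z + <-]]; rewrite (lsq_Zset hf) hD lte_fin.
move=> [Xz Az]; rewrite ltr_pM2l ?invr_gt0// ltr_pXn2r ?nnegrE//; last 2 first.
- exact: is_norm_ge0.
- by rewrite mulr_ge0// ltW.
move=> Nz; apply: le_trans (_ : (N (t^-1 *: (z - x)))%:E <= _)%E.
  apply: ereal_inf_lbound; exists (t^-1 *: (z - x)) => //; split.
    apply: tangent_coneZ => //; first by rewrite invr_ge0 ltW.
    exact: tangent_cone_sub.
  rewrite -scalemxAr mulmxBr Az -mulmxBr yx scalerA mulVf ?gt_eqF//.
  by rewrite scale1r.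
by rewrite lee_fin NZ gtr0_norm ?invr_gt0// ler_pdivrMl// ltW.
Qed.

(** If the infimum [s] exceeded [2^-1 * (M * a) ^+ 2], a radius halfway between [M * a] and the root
    of [2 * s] would yield a point of [Zset f X y] closer than the infimum allows. *)
Lemma is_modulus_error_bound (M mu : R) : 0 <= M -> 0 <= mu ->
  mu * M ^+ 2 <= 1 ->
  (forall x y (r : R), X x -> X y -> M * enorm (A *m (y - x)) < r ->
    exists2 z, X z & A *m z = A *m y /\ N (z - x) <= r) ->
  is_modulus mu.
Proof.
move=> M0 mu0 muM eb; split=> // x y Xx Xy.
have [s s0 sE] := set_dist_real x Xy.
rewrite set_dist_bregman// sE -EFinM lee_fin.
set a := enorm _; have a0 : 0 <= a := enorm_ge0 _.
have sM : s <= 2^-1 * (M * a) ^+ 2.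
  rewrite leNgt; apply/negP => Ms.
  pose w := Num.sqrt (2 * s).
  have w2 : w ^+ 2 = 2 * s by rewrite sqr_sqrtr// mulr_ge0.
  have w0 : 0 <= w := sqrtr_ge0 _.
  have Maw : M * a < w.
    by rewrite -(ltr_pXn2r (n := 2)) ?nnegrE ?mulr_ge0// w2; lra.
  have [z Xz [Az Nz]] := eb x y ((M * a + w) / 2) Xx Xy ltac:(rewrite -/a; lra).
  have : (set_dist D (Zset f X y) x <= (D z x)%:E)%E.
    by apply: ereal_inf_lbound; exists z => //; rewrite (lsq_Zset hf).
  rewrite sE lee_fin hD => sN.
  have : N (z - x) ^+ 2 < w ^+ 2.
    rewrite ltr_pXn2r ?nnegrE ?is_norm_ge0//; lra.
  by rewrite w2; lra.
apply: le_trans (ler_wpM2l mu0 sM) _.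
by rewrite exprMn mulrCA ler_pM2l ?invr_gt0// mulrA ler_piMl// sqr_ge0.
Qed.

End RelativeConstant.

(** * The relative constant as a minimum over minimal cones *)

Unset Implicit Arguments.

Theorem corollary2 (R : realType) (m n : nat) (N : 'cV[R]_n -> R)
    (A : 'M[R]_(m, n)) (b : 'cV[R]_m) (X : set 'cV[R]_n)
    (f : 'cV[R]_n -> R) (D : 'cV[R]_n -> 'cV[R]_n -> R)
    (hN : is_norm N)
    (hD : forall x y, D x y = 2^-1 * N (x - y) ^+ 2)
    (hf : forall x, f x = 2^-1 * enorm (A *m x - b) ^+ 2)
    (hX : polyhedron X)
    (hAX : exists u v, [/\ mximage A X u, mximage A X v & u != v]) :
  is_minimum
    [set ((cone_inv_norm N A C ^+ 2)^-1)%E | C in min_linear_tangent_cone A X]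
    (rel_strong_convexity f X D).
Proof.
have cX := polyhedron_convex hX; have clX := polyhedron_closed hX.
have [J [F JF]] := finite_tangent_cones hX.
have [u [_ [[xu Xxu _] _ _]]] := hAX.
pose lin j := linear_tangent_cone A X (F j).
have le_rel x : X x -> (rel_strong_convexity f X D <=
    (cone_inv_norm N A (tangent_cone X x) ^+ 2)^-1)%E.
  move=> Xx; apply: ge_ereal_sup => _ [mu mod <-].
  exact: (modulus_le_cone hN hD hf Xx mod).
(* Choose [x0] with maximal tangent cone, i.e. minimal complement. The midpoint [z] of [x0] and [y]
   has a cone containing those of both; by maximality it equals the cone at [x0], which thus
   contains [x0 - y]. *)
have [x0 Xx0 Lx0] : exists2 x0, X x0 & linear_at X A x0.
  pose P j := exists2 x, X x & tangent_cone X x = F j.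
  have [ju Fu] := JF _ Xxu.
  have Pu : P ju by exists xu.
  have [j [[x0 Xx0 Fj] _] jmax] := finite_minimal_subset (fun j => ~` F j) Pu.
  exists x0 => //; apply/(linear_atP cX A Xx0) => y Xy.
  exists (x0 - y) => //.
  pose z := x0 + 2^-1 *: (y - x0).
  have Xz : X z by apply: cX => //; lra.
  have [k Fk] := JF _ Xz; have Pk : P k by exists z.
  have jk : F j `<=` F k.
    rewrite -Fj -Fk; apply: tangent_cone_segment => //; lra.
  have /(congr1 setC) := jmax _ Pk (subsetC jk); rewrite !setCK => kj.
  rewrite Fj -kj -Fk.
  have -> : z = y + 2^-1 *: (x0 - y).
    by apply/colP => i; rewrite !mxE; field.
  apply: tangent_cone_segment (tangent_cone_sub _ Xx0) => //; lra.
pose Pm j := min_linear_tangent_cone A X (F j).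
have min_below x : X x -> linear_at X A x ->
    exists2 j, Pm j & F j `<=` tangent_cone X x.
  move=> Xx Lx; have [i Fi] := JF _ Xx.
  have lin_i : lin i by rewrite /lin -Fi; split=> //; exists x.
  have [j [lin_j ji] jmin] := finite_minimal_subset F lin_i.
  exists j; last by rewrite Fi.
  split=> // C [[y Xy <-] Ly]; have [k Fk] := JF _ Xy; rewrite Fk => kj.
  by apply: jmin => //; rewrite /lin -Fk; split=> //; exists y.
have [j0 Pj0 _] := min_below _ Xx0 Lx0.
(* The largest norm gives the smallest inverse square. *)
have [j Pj jmax] := finite_max (fun j => cone_inv_norm N A (F j)) Pj0.
have [[[xj Xxj Fj] _] _] := Pj.
split; last first.
  by move=> _ [C [[[x Xx <-] _] _] <-]; exact: le_rel.
exists (F j) => //; apply/eqP; rewrite eq_le; apply/andP; split; last first.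
  by rewrite -Fj; exact: le_rel.
have sup_ge mu : is_modulus X f D mu ->
    (mu%:E <= rel_strong_convexity f X D)%E.
  by move=> mod; apply: ereal_sup_ubound; exists mu.
have g0 : (0 <= cone_inv_norm N A (F j))%E.
  by rewrite -Fj; exact: cone_inv_norm_ge0.
case gE : (cone_inv_norm N A (F j)) g0 => [M||//].
  rewrite lee_fin => M0; have mod mu : 0 <= mu -> mu * M ^+ 2 <= 1 ->
      is_modulus X f D mu.
    move=> mu0 muM; apply: (is_modulus_error_bound hN hD hf M0 mu0 muM).
    (* Preimages are taken in a minimal cone inside the cone at [z], where [M] bounds the norm by
       the choice of [j]. *)
    apply: error_bound Xx0 Lx0 M0 _ => // z x y M' Xz Lz Xx Xy MM'.
    have [k Pk kz] := min_below _ Xz Lz.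
    have [[[xk Xxk Fk] Lk] _] := Pk.
    rewrite -Fk in kz Lk.
    have Axy := linear_at_sub cX Xxk Xy Xx Lk.
    have Mk : (cone_inv_norm N A (tangent_cone X xk) <= M%:E)%E.
      by rewrite Fk -gE; exact: jmax.
    have [d Td Ad] := cone_inv_norm_lift hN Xxk Mk MM' Axy.
    by exists d => //; exact: kz.
  (* For [M = 0] the inverse is [+oo], and every [mu >= 0] is a modulus. *)
  rewrite -EFin_expe inver; case: eqP => [M20|/eqP M2].
    have all_mu mu : 0 <= mu -> (mu%:E <= rel_strong_convexity f X D)%E.
      by move=> mu0; apply/sup_ge/mod => //; rewrite M20 mulr0.
    rewrite leye_eq; case: (rel_strong_convexity f X D) all_mu => [r| |] h //.
      have := h (`|r| + 1) (addr_ge0 (normr_ge0 _) ler01); rewrite lee_fin.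
      by have := ler_norm r; lra.
    by have := h 0 (lexx _).
  apply/sup_ge/mod; first by rewrite invr_ge0 sqr_ge0.
  by rewrite mulVf.
(* For an infinite norm the inverse square is 0, and 0 is always a modulus. *)
have -> : (+oo ^+ 2 = +oo :> \bar R)%E by rewrite expe2 mulyy.
move=> _; apply: (sup_ge 0); split=> // x y Xx Xy.
rewrite mul0e (set_dist_bregman hf x Xy) lee_fin.
by rewrite mulr_ge0 ?invr_ge0// sqr_ge0.
Qed.
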